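(* Let $\mathfrak X$ be a homogeneous tree of degree $q+1$ ($q\geq1$) and fix positive integers $k<\ell$. Call an ordered triple $(f,g,h)$ of functions in $\mathcal F(\mathfrak X)$ a compatible triple if $$U_{\ell-1}(\mu_1)\big(g+U_{k-2}(\mu_1)f\big)=U_{k-1}(\mu_1)\big(h+U_{\ell-2}(\mu_1)f\big).$$ Then the following are equivalent: (i) for every compatible triple $(f,g,h)$ there exists a wave $\{f_j\}_{j\in\mathbb Z}$ with $f_0=f$, $f_k=g$, $f_\ell=h$; (ii) for every compatible triple $(f,g,h)$ there exists $f_1\in\mathcal F(\mathfrak X)$ with $U_{k-1}(\mu_1)f_1=g+U_{k-2}(\mu_1)f$ and $U_{\ell-1}(\mu_1)f_1=h+U_{\ell-2}(\mu_1)f$; (iii) the map $U_{\ell-1}(\mu_1)$, restricted to $\ker U_{k-1}(\mu_1)$, maps $\ker U_{k-1}(\mu_1)$ onto $\ker U_{k-1}(\mu_1)$.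
   Context: $\mathfrak X$ is a tree in which every vertex has exactly $q+1$ edges; $\mathcal F(\mathfrak X)$ is the space of complex-valued functions on its vertices; $\mu_1f(v)=\frac{1}{q+1}\sum_{w\text{ adjacent to }v}f(w)$. A wave is a family $\{f_j\}_{j\in\mathbb Z}$ in $\mathcal F(\mathfrak X)$ with $\mu_1f_j=\frac{f_{j+1}+f_{j-1}}{2}$ for all $j\in\mathbb Z$. $U_n$: Chebyshev polynomials of the second kind, $U_0=1$, $U_1(x)=2x$, $U_n=2xU_{n-1}-U_{n-2}$, with $U_{-n-1}=-U_{n-1}$ for $n\geq0$ (so $U_{-1}=0$); polynomials are applied to the operator $\mu_1$. *)

(* Defs.v *)
From HB Require Import structures.
From mathcomp Require Import all_boot all_order all_algebra.
From mathcomp Require Import all_classical all_reals.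
From mathcomp.real_closed Require Export complex.
Set Implicit Arguments. Unset Strict Implicit. Unset Printing Implicit Defensive.
Import Order.TTheory GRing.Theory Num.Theory.
Local Open Scope classical_set_scope.
Local Open Scope ring_scope.

(* Simple graphs are symmetric irreflexive relations.  Only cycles of length at
   least 3 are excluded: in the sense of [ucycle], a 2-cycle merely runs back
   and forth along an edge. *)
Definition is_tree (V : choiceType) (adj : rel V) : Prop :=
  [/\ symmetric adj,
      irreflexive adj,
      [set: V] !=set0,
      forall v w : V, exists2 p : seq V, path adj v p & last v p = w
    & forall c : seq V, (2 < size c)%N -> ~ ucycle adj c].

(* The degree is [q.+1], not [q]. *)
Definition homogeneous_tree (q : nat) (V : choiceType) (adj : rel V) : Prop :=
  is_tree adj /\ forall v : V, ([set w | adj v w] #= `I_q.+1)%card.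

Definition mu1 (C : fieldType) (q : nat) (V : choiceType) (adj : rel V)
    (f : V -> C) : V -> C :=
  fun v => q.+1%:R^-1 * \sum_(w \in [set w | adj v w]) f w.

Definition is_wave (C : fieldType) (q : nat) (V : choiceType) (adj : rel V)
    (F : int -> V -> C) : Prop :=
  forall (j : int) (v : V), mu1 q adj (F j) v = (F (j + 1) v + F (j - 1) v) / 2.

Fixpoint chebU_nat (C : nzRingType) (n : nat) : {poly C} :=
  match n with
  | 0 => 1
  | 1 => 2 *: 'X
  | (m.+1 as m').+1 => 2 *: 'X * chebU_nat C m' - chebU_nat C m
  end.

(* [Negz n] is the integer - n - 1, where U_{-n-1} = - U_{n-1} and U_{-1} = 0. *)
Definition chebU (C : nzRingType) (z : int) : {poly C} :=
  match z with
  | Posz n => chebU_nat C n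
  | Negz 0 => 0
  | Negz m.+1 => - chebU_nat C m
  end.

Definition poly_op (C : nzRingType) (V : Type) (p : {poly C})
    (T : (V -> C) -> V -> C) (f : V -> C) : V -> C :=
  fun v => \sum_(i < size p) p`_i * iter i T f v.

Definition chebU_mu1 (C : fieldType) (q : nat) (V : choiceType) (adj : rel V)
    (z : int) : (V -> C) -> V -> C :=
  poly_op (chebU C z) (mu1 q adj).

Definition kerU (C : fieldType) (q : nat) (V : choiceType) (adj : rel V)
    (z : int) : set (V -> C) :=
  [set f | chebU_mu1 q adj z f = 0].

Definition compatible_triple (C : fieldType) (q : nat) (V : choiceType)
    (adj : rel V) (k l : nat) (f g h : V -> C) : Prop :=
  let U := chebU_mu1 q adj in
  U (l%:Z - 1) (g + U (k%:Z - 2) f) = U (k%:Z - 1) (h + U (l%:Z - 2) f).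

(* Main.v *)
(* With [f_0] prescribed, a wave is determined by [f_1] through
   [f_j = U_{j-1}(mu_1) f_1 - U_{j-2}(mu_1) f_0], which turns (i) into (ii).
   The implication from (ii) to (iii) is the case [f = g = 0].  For the
   converse, [U_{k-1}(mu_1)] is surjective on all functions: by factoring over
   the complex numbers it is enough that each [mu_1 - a] be surjective, and that
   equation can be solved outwards from a root, since every vertex has a child.
   A preimage of [g + U_{k-2}(mu_1) f] under [U_{k-1}(mu_1)] solves the second
   equation of (ii) up to an element of the kernel, which (iii) removes. *)
Require Import Defs.
From HB Require Import structures.
From mathcomp Require Import all_boot all_order all_algebra.
From mathcomp Require Import all_classical all_reals.
From mathcomp.real_closed Require Import complex.
From mathcomp Require Import ring.
Set Implicit Arguments. Unset Strict Implicit. Unset Printing Implicit Defensive.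
Import Order.TTheory GRing.Theory Num.Theory.
Local Open Scope classical_set_scope.
Local Open Scope ring_scope.

(** * Polynomials in a linear endomorphism of a module *)

Definition poly_act (C : fieldType) (E : lmodType C) (T : {linear E -> E})
    (p : {poly C}) (f : E) : E :=
  \sum_(i < size p) p`_i *: iter i T f.

(** Padding with zero coefficients lets polynomials of different sizes share one index range. *)
Lemma poly_actE (C : fieldType) (E : lmodType C) (T : {linear E -> E})
    (n : nat) (p : {poly C}) (f : E) :
  (size p <= n)%N -> poly_act T p f = \sum_(i < n) p`_i *: iter i T f.
Proof.
move=> len; rewrite /poly_act (big_ord_widen n (fun i => p`_i *: iter i T f) len).
rewrite big_mkcond; apply: eq_bigr => i _.
by case: ltnP => // lei; rewrite nth_default // scale0r.
Qed.

Lemma poly_act_linear (C : fieldType) (E : lmodType C) (T : {linear E -> E})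
    (p : {poly C}) : linear (poly_act T p).
Proof.
move=> a f g; rewrite /poly_act scaler_sumr -big_split; apply: eq_bigr => i _ /=.
have -> : iter i T (a *: f + g) = a *: iter i T f + iter i T g.
  by elim: (val i) => //= n ->; rewrite linearP.
by rewrite scalerDr !scalerA mulrC.
Qed.

HB.instance Definition _ (C : fieldType) (E : lmodType C) (T : {linear E -> E})
    (p : {poly C}) :=
  GRing.isLinear.Build C E E *:%R (poly_act T p) (poly_act_linear T p).

Lemma poly_actDl (C : fieldType) (E : lmodType C) (T : {linear E -> E})
    (p r : {poly C}) (f : E) :
  poly_act T (p + r) f = poly_act T p f + poly_act T r f.
Proof.
pose n := maxn (size p) (size r).
rewrite !(@poly_actE _ _ _ n) ?leq_maxl ?leq_maxr ?size_polyD //.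
by rewrite -big_split; apply: eq_bigr => i _; rewrite coefD scalerDl.
Qed.

Lemma poly_actZl (C : fieldType) (E : lmodType C) (T : {linear E -> E})
    (a : C) (p : {poly C}) (f : E) : poly_act T (a *: p) f = a *: poly_act T p f.
Proof.
rewrite (poly_actE _ _ (size_scale_leq a p)) scaler_sumr; apply: eq_bigr => i _.
by rewrite coefZ scalerA.
Qed.

Lemma poly_act0 (C : fieldType) (E : lmodType C) (T : {linear E -> E}) (f : E) :
  poly_act T 0 f = 0.
Proof. by rewrite /poly_act size_poly0 big_ord0. Qed.

Lemma poly_actNl (C : fieldType) (E : lmodType C) (T : {linear E -> E})
    (p : {poly C}) (f : E) : poly_act T (- p) f = - poly_act T p f.
Proof. by rewrite -[X in poly_act T X]scaleN1r poly_actZl scaleN1r. Qed.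

Lemma poly_actC (C : fieldType) (E : lmodType C) (T : {linear E -> E})
    (a : C) (f : E) : poly_act T a%:P f = a *: f.
Proof. by rewrite (poly_actE _ _ (size_polyC_leq1 a)) big_ord1 coefC. Qed.

Lemma poly_act1 (C : fieldType) (E : lmodType C) (T : {linear E -> E}) (f : E) :
  poly_act T 1 f = f.
Proof. by rewrite poly_actC scale1r. Qed.

Lemma poly_actMX (C : fieldType) (E : lmodType C) (T : {linear E -> E})
    (p : {poly C}) (f : E) : poly_act T (p * 'X) f = T (poly_act T p f).
Proof.
rewrite (@poly_actE _ _ _ (size p).+1); last first.
  by apply: leq_trans (size_polyMleq _ _) _; rewrite size_polyX addn2.
rewrite big_ord_recl coefMX scale0r add0r /poly_act linear_sum.
by apply: eq_bigr => i _; rewrite coefMX /= linearZ.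
Qed.

Lemma poly_actX (C : fieldType) (E : lmodType C) (T : {linear E -> E}) (f : E) :
  poly_act T 'X f = T f.
Proof. by rewrite -['X]mul1r poly_actMX poly_act1. Qed.

Lemma poly_actM (C : fieldType) (E : lmodType C) (T : {linear E -> E})
    (p r : {poly C}) (f : E) :
  poly_act T (p * r) f = poly_act T p (poly_act T r f).
Proof.
elim/poly_ind: p => [|p a IHp]; first by rewrite mul0r !poly_act0.
rewrite mulrDl mulrAC !poly_actDl !poly_actMX IHp mul_polyC poly_actZl.
by rewrite poly_actC.
Qed.

(** Over a closed field [p] splits into linear factors, and a composite of surjections is
    surjective. *)
Lemma poly_act_surjective (C : closedFieldType) (E : lmodType C)
    (T : {linear E -> E}) :
  (forall (a : C) (g : E), exists f, T f - a *: f = g) ->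
  forall (p : {poly C}) (g : E), p != 0 -> exists f, poly_act T p f = g.
Proof.
move=> surjT p g; have [rs ->] := closed_field_poly_normal p.
rewrite scaler_eq0 negb_or => /andP[p0 _]; set c := lead_coef p in p0 *.
suff [f Ef] : exists f, poly_act T (\prod_(z <- rs) ('X - z%:P)) f = c^-1 *: g.
  by exists f; rewrite poly_actZl Ef scalerA divff // scale1r.
elim: rs (c^-1 *: g) => [|z rs IHrs] {}g.
  by exists g; rewrite big_nil poly_act1.
have [f' Ef'] := surjT z g; have [f Ef] := IHrs f'.
exists f; rewrite big_cons poly_actM Ef poly_actDl poly_actNl poly_actX.
by rewrite poly_actC.
Qed.

(** * Chebyshev polynomials of integer index *)

Lemma chebU_rec (C : fieldType) (z : int) :
  chebU C (z + 1) = 2 *: 'X * chebU C z - chebU C (z - 1).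
Proof.
(* The values 0, -1 and -2 of [z] stand apart: for them the recurrence involves the special value
   [U_{-1} = 0]. *)
case: z => [[|n]|[|[|n]]].
- by rewrite /= mulr1 subr0.
- have -> : n.+1%:Z + 1 = n.+2%:Z by rewrite -[1]/(1%:Z) -PoszD addn1.
  have -> : n.+1%:Z - 1 = n%:Z by rewrite -addn1 PoszD addrK.
  by [].
- by rewrite /= mulr0 sub0r opprK.
- by rewrite /= mulrN1 opprK addNr.
have -> : Negz n.+2 + 1 = Negz n.+1 by rewrite !NegzE -addn1 PoszD opprD addrNK.
have -> : Negz n.+2 - 1 = Negz n.+3 by rewrite !NegzE -(addn1 n.+3) PoszD opprD.
by rewrite /= mulrN opprK addKr.
Qed.

(** The leading coefficient is [2 ^ n]. This serves to show that [U_{k-1}] is not the zero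
    polynomial. *)
Lemma size_chebU_nat (C : fieldType) (n : nat) : 2 != 0 :> C ->
  size (chebU_nat C n) = n.+1.
Proof.
move=> nz2; elim/ltn_ind: n => -[|[|n]] IHn; first by rewrite size_poly1.
  by rewrite /= size_scale ?size_polyX.
have sizeX : size (2 *: 'X * chebU_nat C n.+1) = n.+3.
  rewrite -scalerAl size_scale // mulrC size_mulX ?IHn //.
  by rewrite -size_poly_eq0 IHn.
rewrite -[LHS]/(size (2 *: 'X * chebU_nat C n.+1 - chebU_nat C n)).
by rewrite size_polyDl ?size_polyN sizeX ?IHn // ltnS leqnSn.
Qed.

(** * Paths in trees *)

Lemma tree_path_unique (V : choiceType) (adj : rel V) (x : V) (s1 s2 : seq V) :
  is_tree adj -> path adj x s1 -> path adj x s2 -> uniq (x :: s1) ->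
  uniq (x :: s2) -> last x s1 = last x s2 -> s1 = s2.
Proof.
move=> [adjC _ _ _ acyc].
elim: s1 x s2 => [|a s1 IH] x s2.
  case: s2 => // b s2 _ _ _ /andP[/negP xs2 _] /= Ex.
  by case: xs2; rewrite {1}Ex mem_last.
case: s2 => [|b s2].
  by move=> _ _ /andP[/negP xs1 _] _ /= Ex; case: xs1; rewrite -{1}Ex mem_last.
move=> path1 path2 uniq1 uniq2 Elast.
have [Eab|neq_ab] := eqVneq a b.
  rewrite Eab in path1 uniq1 Elast *; congr (_ :: _).
  move: path1 path2 uniq1 uniq2 => /= /andP[_ ?] /andP[_ ?].
  by move=> /andP[_ ?] /andP[_ ?]; apply: IH Elast.
(* The two paths branch at [x]; closing them up at the first vertex [z] of
   the first one that lies on the second yields a cycle. *)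
exfalso.
have hasz : has (mem (b :: s2)) (a :: s1).
  apply/hasP; exists (last a s1); first exact: mem_last.
  by rewrite [last a s1]Elast -[mem _ _]/(last b s2 \in b :: s2) mem_last.
(* This will give the cycle at least 3 vertices: if [t1] and [t2] were both empty, both heads would
   be [z]. *)
have : head x (a :: s1) != head x (b :: s2) by [].
case: (split_find hasz) path1 uniq1 => z t1 r1 zs2 disj1 path1 uniq1.
case/splitPr: {s2 b}(b :: s2) / zs2 path2 uniq2 disj1 {neq_ab hasz Elast} => t2 r2.
rewrite -cat_rcons cat_path => /andP[path2 _].
rewrite -cat_cons cat_uniq => /andP[uniq2 _] disj1 neq_head.
move: path1 uniq1; rewrite cat_path -cat_cons cat_uniq.
move=> /andP[path1 _] /andP[uniq1 _].
pose c := (x :: rcons t1 z) ++ rev t2.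
apply: (acyc c).
  rewrite size_cat /= size_rcons size_rev.
  by case: t1 t2 neq_head {disj1 path1 path2 uniq1 uniq2 c} => [|? ?] [|? ?] //=;
    rewrite ?eqxx // !addSn ?addnS.
apply/andP; split.
  rewrite /= rcons_path cat_path path1 last_rcons last_cat last_rcons.
  (* The way back from [z] to [x] is the second path reversed, a path by symmetry of [adj]. *)
  have := rev_path adj x (rcons t2 z); rewrite belast_rcons last_rcons rev_cons.
  rewrite rcons_path => E; rewrite -[X in _ && X]/(adj (last z (rev t2)) x).
  have : path (fun u v => adj v u) x (rcons t2 z).
    by apply: sub_path path2 => u v /=; rewrite adjC.
  by rewrite -E.
rewrite cat_uniq uniq1 rev_uniq.
move: uniq2; rewrite -rcons_cons rcons_uniq => /andP[zt2 /= /andP[xt2 ->]].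
rewrite andbT; apply/hasPn => u; rewrite mem_rev => ut2.
rewrite inE mem_rcons inE !negb_or; apply/and3P; split.
- by apply: contraNneq xt2 => <-.
- by apply: contraNneq zt2 => <-; rewrite inE ut2 orbT.
- apply: contra disj1 => ut1; apply/hasP; exists u => //=.
  by rewrite !(mem_cat, mem_rcons, inE) ut2 !orbT.
Qed.

(** Uniqueness of simple paths gives every clause once [s v] is the path from [v] to the root [o],
    without [v] itself; its head is the parent of [v]. *)
Lemma tree_root_path (V : choiceType) (adj : rel V) (o : V) : is_tree adj ->
  exists s : V -> seq V,
    [/\ s o = [::],
        forall v p t, s v = p :: t -> adj v p /\ s p = t
      & forall v w, adj v w -> s v = w :: s w \/ s w = v :: s v].
Proof.
move=> tree; have [adjC adjF _ conn _] := tree.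
have /choice[s sP] : forall v, exists s,
    [/\ path adj v s, uniq (v :: s) & last v s = o].
  by move=> v; have [t /shortenP[t' ? ? _] Et] := conn v o; exists t'.
have uniqs v t : path adj v t -> uniq (v :: t) -> last v t = o -> t = s v.
  move=> pt ut lt; have [? ? ls] := sP v.
  by apply: (tree_path_unique tree pt) => //; rewrite ls.
exists s; split=> [|v p t sv|v w vw]; first by rewrite -(uniqs o [::]).
  have [] := sP v; rewrite sv => /= /andP[vp pt] /andP[_ ut] lt.
  by rewrite -(uniqs p t).
(* If [w] is off the path of [v], prepending [v] to that path gives the path of [w]. Otherwise [w]
   followed by what comes after it is the path of [v]. *)
have [pv uv lv] := sP v; have [wv|wv] := boolP (w \in s v); last first.
  right; rewrite -(uniqs w (v :: s v)) //=; first by rewrite adjC vw.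
  move: uv => /= ->; rewrite inE negb_or wv !andbT.
  by apply: contraTneq vw => ->; rewrite adjF.
left; case/splitPr def_sv: _ / wv => [s1 s2].
move: pv uv lv; rewrite def_sv cat_path last_cat => /andP[_ /andP[_ pw]] uv lw.
have uw : uniq (v :: w :: s2).
  apply: (subseq_uniq _ uv : uniq (v :: w :: s2)).
  by rewrite /= eqxx suffix_subseq.
rewrite -def_sv -(uniqs v (w :: s2)) //= ?vw //.
by rewrite -(uniqs w s2) //; case/andP: uw.
Qed.

(** * Linearity of the averaging operator and surjectivity of its translates *)

Lemma mu1_linear (C : fieldType) (q : nat) (V : choiceType) (adj : rel V) :
  (forall v, finite_set [set w | adj v w]) ->
  linear (mu1 q adj : (V -> C^o) -> (V -> C^o)).
Proof.
move=> fin a f g; apply/funext => v.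
rewrite /mu1 -[RHS]/(a * (_ * _) + _ * _) mulrCA -mulrDr; congr (_ * _).
(* Finiteness matters here: the sum would default to 0 on infinite support and fail to be
   additive. *)
rewrite !fsbig_finite //= big_distrr.
by rewrite -big_split.
Qed.

(* Rooting the tree at [o], the value of the solution [f] at a vertex [w] is
   computed along the path from [w] to [o]; it vanishes unless [w] is the
   chosen child [c v] of its parent [v], where it solves the equation at [v]. *)
Fixpoint path_solution (C : fieldType) (q : nat) (V : choiceType) (c : V -> V)
    (a : C) (g : V -> C) (s : seq V) (w : V) : C :=
  match s with
  | [::] => 0
  | v :: s' =>
    if w == c v then
      q.+1%:R * (a * path_solution q c a g s' v + g v)
      - match s' with
        | [::] => 0
        | u :: s'' => path_solution q c a g s'' u
        end
    else 0
  end.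

(** In the equation at [v] the values at [v] and its parent are already fixed; one child absorbs
    what is required and the others carry 0. *)
Lemma mu1_sub_surjective (C : fieldType) (q : nat) (V : choiceType)
    (adj : rel V) (a : C) (g : V -> C) :
  q.+1%:R != 0 :> C -> (1 <= q)%N -> homogeneous_tree q adj ->
  exists f : V -> C, forall v, mu1 q adj f v - a * f v = g v.
Proof.
move=> nzq q_gt0 [tree deg]; have [_ _ [o _] _ _] := tree.
have fin v : finite_set [set w | adj v w] by exists q.+1; exact: deg.
have [s [_ sE parent]] := tree_root_path o tree.
have neighbour v u : exists w, adj v w /\ w <> u.
  apply: contrapT => none.
  have : [set w | adj v w] `<=` [set u].
    by move=> w vw; apply: contrapT => wu; apply: none; exists w.
  have /card_eqPle[_ le_deg] := deg v.
  move=> /subset_card_le /(card_le_trans le_deg) le1.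
  have /card_eqPle[le2 _] := @card_set1 _ u.
  have := card_le_trans le1 le2; rewrite card_le_II.
  by rewrite ltnS leqNgt q_gt0.
(* The head is the parent of [v]; at the root it defaults to [v], which is no neighbour of
   itself. *)
have /choice[c cP] : forall v, exists w, adj v w /\ w <> head v (s v).
  by move=> v; exact: neighbour.
have child v : s (c v) = v :: s v.
  have [vc nhead] := cP v; case: (parent v (c v) vc) => // sv.
  by case: nhead; rewrite sv.
pose f v := path_solution q c a g (s v) v.
exists f => v; rewrite /mu1.
suff -> : \sum_(w \in [set w | adj v w]) f w = q.+1%:R * (a * f v + g v).
  by rewrite mulKf // addrC addKr.
have [vc nhead] := cP v.
have fc : f (c v) = q.+1%:R * (a * f v + g v) -
    match s v with [::] => 0 | u :: s'' => path_solution q c a g s'' u end.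
  by rewrite /f child /= eqxx.
have f0 w : adj v w -> s w = v :: s v -> w <> c v -> f w = 0.
  by move=> vw sw /eqP/negPf wc; rewrite /f sw /= wc.
rewrite (fsbigD1 (c v)) //= fc.
case sv: (s v) => [|p t].
  rewrite subr0 fsbig1 ?addr0 // => w [vw wc]; apply: f0 => //.
  by case: (parent v w vw); rewrite sv.
have [vp sp] := sE _ _ _ sv.
(* The parent [p] contributes [f p], which cancels the term subtracted in [fc]. *)
rewrite (fsbigD1 p) /=; last 2 first.
- by apply: sub_finite_set (fin v) => w [].
- by split=> // pc; apply: nhead; rewrite sv -pc.
rewrite fsbig1 => [|w [[vw wc] wp]].
  by rewrite /f sp addr0 subrK.
apply: f0 => //; case: (parent v w vw); rewrite sv => // -[pw _].
by case: wp; exact: esym.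
Qed.

(** * Waves expressed through Chebyshev polynomials *)

Definition cheb_wave (C : fieldType) (E : lmodType C) (T : {linear E -> E})
    (f0 f1 : E) (j : int) : E :=
  poly_act T (chebU C (j - 1)) f1 - poly_act T (chebU C (j - 2)) f0.

Lemma cheb_wave0 (C : fieldType) (E : lmodType C) (T : {linear E -> E})
    (f0 f1 : E) : cheb_wave T f0 f1 0 = f0.
Proof.
by rewrite /cheb_wave poly_act0 poly_actNl poly_act1 sub0r opprK.
Qed.

Lemma cheb_wave1 (C : fieldType) (E : lmodType C) (T : {linear E -> E})
    (f0 f1 : E) : cheb_wave T f0 f1 1 = f1.
Proof. by rewrite /cheb_wave poly_act0 poly_act1 subr0. Qed.

Lemma cheb_wave_rec (C : fieldType) (E : lmodType C) (T : {linear E -> E})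
    (f0 f1 : E) (j : int) :
  cheb_wave T f0 f1 (j + 1) =
    2 *: T (cheb_wave T f0 f1 j) - cheb_wave T f0 f1 (j - 1).
Proof.
have actU z f : poly_act T (chebU C (z + 1)) f =
    2 *: T (poly_act T (chebU C z) f) - poly_act T (chebU C (z - 1)) f.
  rewrite chebU_rec -scalerAl poly_actDl poly_actNl poly_actZl.
  by rewrite mulrC poly_actMX.
rewrite /cheb_wave.
have -> : j + 1 - 1 = (j - 1) + 1 by ring.
have -> : j + 1 - 2 = (j - 2) + 1 by ring.
have -> : j - 1 - 2 = (j - 2) - 1 by ring.
rewrite !actU (raddfB T) scalerBr !opprB addrACA [in RHS]addrACA.
by congr (_ + _); rewrite addrC.
Qed.

(** Both sides obey the same second-order recurrence and agree at 0 and 1. Natural indices suffice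
    for evaluation at [k] and [l]. *)
Lemma cheb_wave_unique (C : fieldType) (E : lmodType C) (T : {linear E -> E})
    (F : int -> E) (n : nat) :
  (forall j, F (j + 1) = 2 *: T (F j) - F (j - 1)) ->
  F n%:Z = cheb_wave T (F 0) (F 1) n%:Z.
Proof.
move=> recF; elim/ltn_ind: n => -[|[|n]] IHn.
- by rewrite cheb_wave0.
- by rewrite cheb_wave1.
have -> : n.+2%:Z = n.+1%:Z + 1 by rewrite -addn1 PoszD.
have En : n.+1%:Z - 1 = n%:Z by rewrite -addn1 PoszD addrK.
by rewrite recF cheb_wave_rec En (IHn n.+1) ?(IHn n).
Qed.

Lemma is_waveP (C : fieldType) (q : nat) (V : choiceType) (adj : rel V)
    (F : int -> V -> C^o) : 2 != 0 :> C ->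
  is_wave q adj F <->
  forall j, F (j + 1) = 2 *: (mu1 q adj (F j) : V -> C^o) - F (j - 1).
Proof.
move=> nz2; split=> wF j.
  apply/funext => v; rewrite -[RHS]/(2 * mu1 q adj (F j) v - F (j - 1) v).
  by rewrite wF mulrCA divff // mulr1 addrK.
move=> v; rewrite wF.
rewrite -[X in _ = X / 2]/(2 * mu1 q adj (F j) v - F (j - 1) v + F (j - 1) v).
by rewrite subrK mulrC mulKf.
Qed.

(** Scaling in [C^o] is multiplication, so the module calculus above applies to operators on
    functions. *)
Lemma poly_op_act (C : fieldType) (V : Type)
    (T : {linear (V -> C^o) -> (V -> C^o)}) (p : {poly C}) : poly_op p T = poly_act T p.
Proof.
by apply/funext => f; apply/funext => v; rewrite /poly_op /poly_act fct_sumE.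
Qed.

Theorem theorem5p4 (R : realType) (q : nat) (V : choiceType) (adj : rel V)
    (k l : nat) (hq : (1 <= q)%N) (htree : homogeneous_tree q adj)
    (hk : (0 < k)%N) (hkl : (k < l)%N) :
  let U : int -> (V -> R[i]) -> V -> R[i] := chebU_mu1 q adj in
  let wave_extension : Prop :=
    forall f g h : V -> R[i], compatible_triple q adj k l f g h ->
      exists F : int -> V -> R[i],
        [/\ is_wave q adj F, F 0 = f, F k%:Z = g & F l%:Z = h] in
  let common_solution : Prop :=
    forall f g h : V -> R[i], compatible_triple q adj k l f g h ->
      exists f1 : V -> R[i],
        U (k%:Z - 1) f1 = g + U (k%:Z - 2) f
        /\ U (l%:Z - 1) f1 = h + U (l%:Z - 2) f in
  let kernel_onto : Prop :=
    U (l%:Z - 1) @` kerU q adj (k%:Z - 1) = kerU q adj (k%:Z - 1) in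
  (wave_extension <-> common_solution) /\ (common_solution <-> kernel_onto).
Proof.
move=> U wave_extension common_solution kernel_onto.
have fin v : finite_set [set w | adj v w] by exists q.+1; exact: htree.2.
have nzn n : n.+1%:R != 0 :> R[i] by rewrite pnatr_eq0.
pose T : {linear (V -> R[i]^o) -> (V -> R[i]^o)} :=
  HB.pack (mu1 q adj : (V -> R[i]^o) -> (V -> R[i]^o))
    (GRing.isLinear.Build _ _ _ _ _ (mu1_linear q fin)).
have UE z : U z = poly_act T (chebU R[i] z) by exact: (poly_op_act T).
have UC z z' f : U z (U z' f) = U z' (U z f).
  by rewrite !UE -!poly_actM mulrC.
have UB z f g : U z (f - g) = U z f - U z g.
  by rewrite !UE; exact (linearB (poly_act T (chebU R[i] z)) f g).
have U0 z : U z 0 = 0.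
  by rewrite !UE; exact (linear0 (poly_act T (chebU R[i] z))).
have waveE f0 f1 j : cheb_wave T f0 f1 j = U (j - 1) f1 - U (j - 2) f0.
  by rewrite !UE.
have surjU (g : V -> R[i]) : exists f, U (k%:Z - 1) f = g.
  (* As [k] is positive, [k - 1] is a natural number and [chebU] reduces to [chebU_nat]. *)
  rewrite -predn_int // UE.
  apply: poly_act_surjective => [a {}g|].
    have [f Ef] := mu1_sub_surjective a g (nzn q) hq htree.
    by exists f; apply/funext => v; rewrite -[RHS]Ef.
  by rewrite -size_poly_eq0 size_chebU_nat.
split.
  split=> H f g h /H.
    move=> [F [/(is_waveP _ _ _ (nzn 1)) wF <- <- <-]]; exists (F 1).
    have FE (n : nat) := @cheb_wave_unique _ _ T F n wF.
    by split; rewrite FE waveE subrK.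
  move=> [f1 [Ek El]]; exists (cheb_wave T f f1); split.
  - by apply/(is_waveP _ _ _ (nzn 1)) => j; exact: cheb_wave_rec.
  - exact: cheb_wave0.
  - by rewrite waveE Ek addrK.
  - by rewrite waveE El addrK.
split=> [H|onto f g h].
  apply/seteqP; split=> [_ [f f0 <-]|f f0].
    by rewrite /kerU /= -/U UC [X in U _ X]f0 U0.
  (* The triple [(0, 0, f)] is compatible because [U_{k-1}] kills [f], and [f1] is then the preimage
     sought. *)
  have [|f1 []] := H 0 0 f.
    by rewrite /compatible_triple -/U !U0 !addr0 U0 [RHS]f0.
  by rewrite !U0 !addr0; exists f1.
rewrite /compatible_triple -/U; set G := g + _; set K := h + _ => GK.
have [p Ep] := surjU G.
(* Compatibility puts the error of [p] in the second equation into the kernel. Subtracting a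
   preimage [r] of it in the kernel leaves the first equation intact. *)
have : kerU q adj (k%:Z - 1) (U (l%:Z - 1) p - K).
  by rewrite /kerU /= -/U UB UC Ep GK subrr.
rewrite -onto => -[r r0 Er]; exists (p - r); rewrite !UB Ep [U _ r]r0 subr0.
by rewrite Er subKr.
Qed.
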